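(* Let $2<n<\omega$. Let $\mathsf{RCA}_n^+$ be a first-order definable expansion of $\mathsf{RCA}_n$ such that the non-cylindric operations are first-order definable by formulas using only finitely many variables $l>n$. If $\mathsf{RCA}_n^+$ is completely additive, then it is not atom-canonical.
   Context: $\mathsf{RCA}_n$ is the class of representable cylindric algebras of dimension $n$ (isomorphic to subdirect products of cylindric set algebras ${\wp}({}^nU)$-subalgebras). A first-order definable expansion $\mathsf{RCA}_n^+$ is obtained by adding finitely many new operation symbols, each interpreted on a cylindric set algebra with base $U$ by a fixed first-order formula (with free variables among the first $n$, whose relation symbols stand for the arguments of the operation), and taking the class of (isomorphic copies of) subalgebras of products of the resulting expanded set algebras; $\mathsf{RCA}_n^+$ is a variety. It is completely additive if all its operations preserve all existing joins. A completely additive class $\mathsf V$ is atom-canonical if $\mathfrak{Cm}\mathsf{At}\mathfrak A\in\mathsf V$ for every atomic $\mathfrak A\in\mathsf V$, where $\mathfrak{Cm}\mathsf{At}\mathfrak A$ is the complex algebra over the atom structure of $\mathfrak A$. *)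

(* Defs.v *)
From HB Require Import structures.
From mathcomp Require Import all_boot all_order.
From mathcomp Require Import boolp classical_sets.

Set Implicit Arguments.
Unset Strict Implicit.
Unset Printing Implicit Defensive.

Import Order.TTheory.

Local Open Scope classical_set_scope.

(** * First-order formulas *)

(* Formulas with equality over the variables v_0, v_1, ... and [k] relation
   symbols, all of rank [n]: the [r]-th symbol stands for the [r]-th argument,
   an [n]-ary relation, of the operation the formula defines. *)
Inductive fo_formula (n k : nat) : Type :=
| FoRel (r : 'I_k) (x : n.-tuple nat)
| FoEq (x y : nat)
| FoNot (f : fo_formula n k)
| FoAnd (f g : fo_formula n k)
| FoEx (x : nat) (f : fo_formula n k).

Arguments FoRel {n k} r x.
Arguments FoEq {n k} x y.

Fixpoint fo_free n k (f : fo_formula n k) : seq nat :=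
  match f with
  | FoRel _ x => x
  | FoEq x y => [:: x; y]
  | FoNot f => fo_free f
  | FoAnd f g => fo_free f ++ fo_free g
  | FoEx x f => [seq y <- fo_free f | y != x]
  end.

Fixpoint fo_vars n k (f : fo_formula n k) : seq nat :=
  match f with
  | FoRel _ x => x
  | FoEq x y => [:: x; y]
  | FoNot f => fo_vars f
  | FoAnd f g => fo_vars f ++ fo_vars g
  | FoEx x f => x :: fo_vars f
  end.

Fixpoint fo_sat n k (U : Type) (X : 'I_k -> set ('I_n -> U))
    (f : fo_formula n k) (s : nat -> U) : Prop :=
  match f with
  | FoRel r x => X r (fun i => s (tnth x i))
  | FoEq x y => s x = s y
  | FoNot f => ~ fo_sat X f s
  | FoAnd f g => fo_sat X f s /\ fo_sat X g s
  | FoEx x f => exists u : U, fo_sat X f [eta s with x |-> u]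
  end.

(* When the free variables of [f] are among v_0, ..., v_(n-1) and [0 < n],
   the choice of the assignment [s] extending [t] is immaterial. *)
Definition fo_op n k (f : fo_formula n k) (U : Type)
    (X : 'I_k -> set ('I_n -> U)) : set ('I_n -> U) :=
  [set t | exists2 s : nat -> U, (forall i : 'I_n, s i = t i) & fo_sat X f s].

(* The finitely many operation symbols added to the cylindric ones, with their
   arities and defining formulas. *)
Record fo_expansion (n : nat) := FoExpansion {
  op_sym : finType;
  op_ar : op_sym -> nat;
  op_def : forall o : op_sym, fo_formula n (op_ar o);
  op_free : forall o x, x \in fo_free (op_def o) -> x < n
}.

(** * Algebras of the expanded similarity type *)

Record cyl_alg n (E : fo_expansion n) := CylAlg {
  ca_disp : Order.disp_t;
  ca_sort :> ctbDistrLatticeType ca_disp;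
  cyl : 'I_n -> ca_sort -> ca_sort;
  diag : 'I_n -> 'I_n -> ca_sort;
  ext : forall o : op_sym E, ('I_(op_ar o) -> ca_sort) -> ca_sort
}.

Arguments diag {n E} A i j : rename.
Arguments ext {n E} A o x : rename.

Record is_hom n (E : fo_expansion n) (A B : cyl_alg E) (h : A -> B) : Prop :=
  IsHom {
  hom_join : forall x y, h (Order.join x y) = Order.join (h x) (h y);
  hom_meet : forall x y, h (Order.meet x y) = Order.meet (h x) (h y);
  hom_compl : forall x, h (Order.compl x) = Order.compl (h x);
  hom_bottom : h Order.bottom = Order.bottom;
  hom_top : h Order.top = Order.top;
  hom_cyl : forall i x, h (cyl i x) = cyl i (h x);
  hom_diag : forall i j, h (diag A i j) = diag B i j;
  hom_ext : forall o x, h (ext A o x) = ext B o (h \o x)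
}.

(* The Boolean part is the powerset lattice of mathcomp.classical. *)
Definition full_set_alg n (E : fo_expansion n) (U : Type) : cyl_alg E :=
  @CylAlg n E _ (set ('I_n -> U))
    (fun i X => [set s | exists2 t, X t & forall j, j != i -> s j = t j])
    (fun i j => [set s | s i = s j])
    (fun o X => fo_op (op_def o) X).

(* [A] embeds into a product of full expanded set algebras; the embedding is
   given by its coordinates [h i]. Subalgebras of full set algebras give the
   same class, and an empty base only contributes a trivial factor. *)
Definition RCA_plus n (E : fo_expansion n) (A : cyl_alg E) : Prop :=
  exists (I : Type) (U : I -> Type) (h : forall i, A -> full_set_alg E (U i)),
    (forall i, is_hom (h i)) /\
    (forall x y : A, (forall i, h i x = h i y) -> x = y).

(** * Complete additivity *)

(* Includes the empty join, hence [f] is normal. *)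
Definition preserves_joins d (L : porderType d) (f : L -> L) : Prop :=
  forall (X : set L) (a : L), supremums X a -> supremums (f @` X) (f a).

(* Operations of several arguments are required to preserve joins in each
   argument separately; for constants there is no requirement. *)
Definition alg_completely_additive n (E : fo_expansion n) (A : cyl_alg E) :=
  (forall i : 'I_n, preserves_joins (@cyl n E A i)) /\
  (forall (o : op_sym E) (x : 'I_(op_ar o) -> A) (j : 'I_(op_ar o)),
      preserves_joins (fun y : A => ext A o [eta x with j |-> y])).

Definition completely_additive n (E : fo_expansion n)
    (V : cyl_alg E -> Prop) : Prop :=
  forall A, V A -> alg_completely_additive A.

(** * Atom structures and complex algebras *)

Definition is_atom d (L : ctbDistrLatticeType d) (a : L) : Prop :=
  a != Order.bottom /\
  forall b : L, (b <= a)%O -> b = Order.bottom \/ b = a.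

Definition atomic d (L : ctbDistrLatticeType d) : Prop :=
  forall x : L, x != Order.bottom -> exists2 a, is_atom a & (a <= x)%O.

Record atom_structure n (E : fo_expansion n) := AtomStructure {
  as_sort :> Type;
  as_cyl : 'I_n -> as_sort -> as_sort -> Prop;
  as_diag : 'I_n -> 'I_n -> as_sort -> Prop;
  as_ext : forall o : op_sym E, as_sort -> ('I_(op_ar o) -> as_sort) -> Prop
}.

Definition At n (E : fo_expansion n) (A : cyl_alg E) : atom_structure E :=
  @AtomStructure n E {a : A | is_atom a}
    (fun i a b => (sval a <= cyl i (sval b))%O)
    (fun i j a => (sval a <= diag A i j)%O)
    (fun o a b => (sval a <= ext A o (fun r => sval (b r)))%O).

Definition Cm n (E : fo_expansion n) (W : atom_structure E) : cyl_alg E :=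
  @CylAlg n E _ (set W)
    (fun i X => [set w | exists2 v, X v & as_cyl i w v])
    (fun i j => [set w | as_diag i j w])
    (fun o X => [set w | exists2 v, (forall r, X r (v r)) & as_ext w v]).

Definition atom_canonical n (E : fo_expansion n)
    (V : cyl_alg E -> Prop) : Prop :=
  forall A : cyl_alg E, V A -> atomic A -> V (Cm (At A)).

(* Main.v *)
Require Import Defs.
From HB Require Import structures.
From mathcomp Require Import all_boot all_order.
From mathcomp Require Import boolp classical_sets.
From mathcomp Require Import zify.

(** Label the edges of the complete graph on [nat] with finitely many shades
    and, in each shade, tones [(i, k)] (level [i], finitely many hues [k]) or a
    limit tone of infinite level. A triangle is forbidden when it has a single
    shade and its two lowest tones have the same hue, the limit tone having a
    hue different from every hue, its own included. With more than [l] shades,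
    there is such a labelling in which every admissible one-point extension of
    at most [l] points is realized.

    Forget the tones of level at least [m]. By a back-and-forth argument the
    relations that only depend on the resulting coarse labels, for some [m], are
    closed under operations defined with [l] variables. They form an atomic
    algebra, since a coarse type is always realized without limit tones, and a
    limit-free type is isolated. In the complex algebra, however, the sets
    "shade [d], hue [k], any level" are finitely many, cover all edges and
    contain no triangle, so that by Ramsey's theorem a representation has a
    finite base, whereas the infinitely many levels require an infinite one. *)

Set Implicit Arguments.
Unset Strict Implicit.
Unset Printing Implicit Defensive.

Import Order.TTheory.

Local Open Scope classical_set_scope.

(** * Fresh elements and the combinatorics of tones *)

Lemma fresh_injection (p l : nat) (r : seq 'I_p.+1) : size r + l <= p.+1 ->
  exists g : nat -> 'I_p.+1, (forall i, i < l -> g i \notin r) /\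
    (forall i j, i < l -> j < l -> g i = g j -> i = j).
Proof.
move=> le_rl; pose e := enum [predC r].
have le_le : l <= size e.
  rewrite -cardE; have := cardC (mem r); rewrite card_ord => cE.
  have le_r := card_size r; rewrite -(leq_add2l #|r|).
  by rewrite cE (leq_trans _ le_rl) // leq_add2r.
exists (nth ord0 e); split=> [i lt_il|i j lt_il lt_jl eq_g].
  have : nth ord0 e i \in e by apply: mem_nth; apply: leq_trans le_le.
  by rewrite mem_enum inE.
apply/eqP; rewrite -(nth_uniq ord0 _ _ (enum_uniq [predC r])) -/e ?eq_g //;
  exact: leq_trans le_le.
Qed.

Section Tones.
Variable p : nat.

(* A tone is a level together with a hue, or the limit tone [None], whose level
   is infinite. *)
Definition tone := option (nat * 'I_p).
Implicit Types a b c : tone.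

Definition tone_le a b :=
  if b is Some y then if a is Some x then x.1 <= y.1 else false else true.

Definition tone_diff a b :=
  if a is Some x then if b is Some y then x.2 != y.2 else true else true.

(** The third tone is taken as the highest. When levels tie, [tone_ok] accepts any choice of the
    highest tone that works. *)
Definition tone_ok3 a b c := [&& tone_le a c, tone_le b c & tone_diff a b].

Definition tone_ok a b c := [|| tone_ok3 a b c, tone_ok3 a c b | tone_ok3 b c a].

Lemma tone_diffC a b : tone_diff a b = tone_diff b a.
Proof. by case: a b => [x|] [y|] //=; rewrite eq_sym. Qed.

Lemma tone_ok3C a b c : tone_ok3 a b c = tone_ok3 b a c.
Proof. by rewrite /tone_ok3 tone_diffC andbCA. Qed.

Lemma tone_okC a b c : tone_ok a b c = tone_ok b a c.
Proof.
rewrite /tone_ok tone_ok3C; congr (_ || _); exact: orbC.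
Qed.

Lemma tone_okA a b c : tone_ok a b c = tone_ok a c b.
Proof.
by rewrite /tone_ok (tone_ok3C b c) orbCA.
Qed.

(** One limit tone can serve as the highest, and the other differs in hue from everything. This
    makes the limit tone a safe default at a new point. *)
Lemma tone_ok_limit a : tone_ok None None a.
Proof. by rewrite /tone_ok /tone_ok3 /=; case: a => [x|] //=; rewrite orbT. Qed.

Definition tone_trunc m a : tone :=
  if a is Some x then if x.1 < m then a else None else None.

Definition tone_lower m k a : tone :=
  if tone_trunc m a is Some x then a else Some (m, k).

(* In the extension step, [a] and [b] are the edges at the new point and [c], which
   is replaced by the coarsely equal [c'], is the old edge. Level [m] works
   because it is lowest among those that truncation forgets. *)
Lemma tone_ok_lower m a b c c' (k k' : 'I_p) :
  tone_trunc m c = tone_trunc m c' -> k != k' ->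
  (forall d, d \in [:: a; b; c'] ->
     tone_diff d (Some (m, k)) && tone_diff d (Some (m, k'))) ->
  tone_ok a b c -> tone_ok (tone_lower m k a) (tone_lower m k' b) c'.
Proof.
move=> eq_c ne_k fresh.
have /andP[a1 a2] := fresh a (mem_head _ _).
have b_in : b \in [:: a; b; c'] by rewrite !inE eqxx orbT.
have c_in : c' \in [:: a; b; c'] by rewrite !inE eqxx !orbT.
have /andP[b1 b2] := fresh b b_in; have /andP[c1 c2] := fresh c' c_in.
have ne_k' : k' != k by rewrite eq_sym.
move: eq_c a1 a2 b1 b2 c1 c2 {fresh b_in c_in}; rewrite /tone_lower /tone_trunc.
rewrite /tone_ok /tone_ok3.
case: a => [[i x]|]; case: b => [[j y]|]; case: c => [[h z]|];
  case: c' => [[h' z']|] //=.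
all: repeat case: (ltnP _ m) => /= ?.
all: try by [].
all: try (case=> ? ?; subst).
all: rewrite ?ne_k ?ne_k' ?leqnn.
all: move=> a1 a2 b1 b2 c1 c2; rewrite ?a1 ?a2 ?b1 ?b2 ?c1 ?c2 ?(eq_sym _ x) ?(eq_sym _ y).
all: rewrite ?(eq_sym k) ?(eq_sym k') ?a1 ?a2 ?b1 ?b2 ?c1 ?c2.
all: clear a1 a2 b1 b2 c1 c2 ne_k ne_k'.
all: try (clear k k').
all: lia.
Qed.

End Tones.

(** * The labelling of the complete graph on the natural numbers *)

Section Model.
Variables l p : nat.

Definition label := ('I_l.+1 * tone p.+1)%type.

Definition label_ok (a b c : label) :=
  (a.1 == b.1) && (b.1 == c.1) ==> tone_ok a.2 b.2 c.2.

Lemma label_okC a b c : label_ok a b c = label_ok b a c.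
Proof.
by rewrite /label_ok tone_okC eq_sym; case: eqP => //= ->.
Qed.

Lemma label_okA a b c : label_ok a b c = label_ok a c b.
Proof.
rewrite /label_ok tone_okA; congr (_ ==> _).
by rewrite (eq_sym c.1); case: (b.1 =P c.1) => [->|]; rewrite ?andbF.
Qed.

(* The second component of the codes is never used: it makes every code occur
   above any given bound. *)
Definition code (v : nat) : seq nat * seq label :=
  if @unpickle ((seq nat * seq label) * nat)%type v is Some (q, _) then q else ([::], [::]).

Lemma code_unbounded q b : exists2 v, b <= v & code v = q.
Proof.
pose g (i : nat) := @pickle ((seq nat * seq label) * nat)%type (q, i).
have [i le_bi] : exists i, b <= g i.
  apply: contrapT => noi.
  have g_lt (i : 'I_b.+1) : g i < b by rewrite ltnNge; apply/negP=> ?; apply: noi; exists i.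
  have /leq_card : injective (fun i => Ordinal (g_lt i)).
    by move=> i j /(congr1 val)/(pcan_inj pickleK)[/val_inj].
  by rewrite !card_ord ltnn.
by exists (g i) => //; rewrite /code pickleK.
Qed.

(** A code requests a one-point extension: a list of old points and, in the same order, the labels
    of the edges to them. *)
Definition attach (q : seq nat * seq label) x : label :=
  nth (ord0, None) q.2 (index x q.1).

Definition admissible (lb : nat -> nat -> label) v (q : seq nat * seq label) :=
  [&& size q.1 <= l, all (fun x => x < v) q.1 &
    all (fun x => all (fun y => (x == y) ||
      label_ok (attach q x) (attach q y) (lb x y)) q.1) q.1].

(** The fallback is the empty request, which is always admissible, so every number can be added as a
    new point. *)
Definition decode lb v := if admissible lb v (code v) then code v else ([::], [::]).

Definition new_shade (q : seq nat * seq label) : 'I_l.+1 :=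
  odflt ord0 [pick d | d \notin [seq (attach q x).1 | x <- q.1]].

(** At most [l] requested edges cannot use up [l.+1] shades, so the default [ord0] is not
    reached. *)
Lemma new_shadeP q x : size q.1 <= l -> x \in q.1 -> (attach q x).1 != new_shade q.
Proof.
move=> le_ql xq; rewrite /new_shade; case: pickP => [d /=|no] /=.
  by apply: contraNneq => <-; exact: map_f.
have [|g [/(_ 0 isT)]] := @fresh_injection l 1 [seq (attach q x).1 | x <- q.1].
  by rewrite size_map addn1.
by have /negbT := no (g 0); rewrite negbK => ->.
Qed.

Definition new_label lb v x : label :=
  let q := decode lb v in
  if x \in q.1 then attach q x else (new_shade q, None).

(** The points are added one at a time, since the edges at [w] depend on the earlier labels through
    the admissibility of the code of [w]. *)
Fixpoint lab_upto v : nat -> nat -> label :=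
  if v is w.+1 then
    fun x y => if x == w then new_label (lab_upto w) w y
               else if y == w then new_label (lab_upto w) w x
               else lab_upto w x y
  else fun _ _ => (ord0, None).

Definition lab x y := lab_upto (maxn x y).+1 x y.

Lemma lab_uptoE v x y : x < v -> y < v -> lab_upto v x y = lab x y.
Proof.
elim: v => // v IHv lt_xv lt_yv /=.
have [->|ne_xv] := eqVneq x v.
  by rewrite /lab (maxn_idPl _) //= eqxx.
have [->|ne_yv] := eqVneq y v.
  by rewrite /lab (maxn_idPr _) //= eqxx (negPf ne_xv).
by apply: IHv; rewrite ltn_neqAle ?ne_xv ?ne_yv.
Qed.

Lemma lab_sym x y : lab x y = lab y x.
Proof.
rewrite /lab maxnC; set v := _.+1; elim: v => //= v IHv.
by case: (eqVneq x v) => [eq_x|_]; case: (eqVneq y v) => [eq_y|_] //; rewrite eq_x eq_y.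
Qed.

Lemma admissible_lab v q : admissible (lab_upto v) v q = admissible lab v q.
Proof.
rewrite /admissible; congr (_ && _).
have [/allP lt_v|//] := boolP (all _ _).
by apply: eq_in_all => x xq; apply: eq_in_all => y yq; rewrite lab_uptoE ?lt_v.
Qed.

Lemma decode_admissible v : admissible lab v (decode lab v).
Proof. by rewrite /decode; case: ifP. Qed.

Lemma labE v x : x < v -> lab v x = new_label lab v x.
Proof.
move=> lt_xv; rewrite /lab (maxn_idPl _) ?(ltnW lt_xv) //= eqxx.
by rewrite /new_label /decode admissible_lab.
Qed.

(** If both edges at [v] are requested, admissibility applies; if exactly one is, the two have
    different shades; if none is, both have the limit tone. *)
Lemma lab_triangle_top (x y v : nat) : x != y -> x < v -> y < v ->
  label_ok (lab v x) (lab v y) (lab x y).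
Proof.
move=> ne_xy lt_xv lt_yv; rewrite (labE lt_xv) (labE lt_yv) /new_label.
have := decode_admissible v; move: (decode lab v) => q /and3P[le_ql _ /allP okq].
have shN := @new_shadeP q _ le_ql.
case: (boolP (x \in q.1)) => xq; case: (boolP (y \in q.1)) => yq.
- by have /allP/(_ _ yq) := okq _ xq; rewrite (negPf ne_xy).
- by rewrite /label_ok /= (negPf (shN _ xq)).
- by rewrite /label_ok /= eq_sym (negPf (shN _ yq)).
- by rewrite /label_ok /= tone_ok_limit implybT.
Qed.

Lemma lab_triangle (x y z : nat) : x != y -> y != z -> x != z ->
  label_ok (lab x y) (lab y z) (lab x z).
Proof.
move=> ne_xy ne_yz ne_xz.
have /or3P[/andP[lt_yx lt_zx]|/andP[lt_xy lt_zy]|/andP[lt_xz lt_yz]] :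
    [|| (y < x) && (z < x), (x < y) && (z < y) | (x < z) && (y < z)] by lia.
- by rewrite label_okA; apply: lab_triangle_top => //; rewrite 1?eq_sym.
- by rewrite (lab_sym x y); apply: lab_triangle_top => //; rewrite 1?eq_sym.
- rewrite (lab_sym y z) (lab_sym x z) label_okA label_okC label_okA.
  apply: lab_triangle_top => //; rewrite 1?eq_sym.
Qed.

Lemma lab_extension (T : seq nat) (f : nat -> label) : size T <= l ->
  (forall x y, x \in T -> y \in T -> x != y -> label_ok (f x) (f y) (lab x y)) ->
  exists v, forall x, x \in T -> v != x /\ lab v x = f x.
Proof.
move=> le_Tl okT; pose q := (T, [seq f x | x <- T]).
(* The sum bounds every point of [T], so [v] is added after all of them and the request is
   admissible there. *)
have [v le_v code_v] := code_unbounded q (\sum_(x <- T) x).+1.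
have attachE x : x \in T -> attach q x = f x.
  by move=> xT; rewrite /attach (nth_map 0) ?index_mem // nth_index.
have lt_v x : x \in T -> x < v.
  by move=> xT; apply: leq_trans le_v; rewrite ltnS (big_rem x) //= leq_addr.
have decode_v : decode lab v = q.
  rewrite /decode code_v ifT //; apply/and3P; split=> //; first exact/allP.
  apply/allP=> x xT; apply/allP=> y yT; rewrite !attachE //.
  by case: eqVneq => //= /okT; apply.
exists v => x xT; split; first by rewrite gtn_eqF // lt_v.
by rewrite labE ?lt_v // /new_label decode_v xT attachE.
Qed.

End Model.

(** * Coarse labels and the back-and-forth argument *)

Section Coarse.
Variable l : nat.

(* Enough hues to avoid those of [l + l * l] given tones with [l] new ones. *)
Definition palette := l + l * l + l.

Notation lab := (@lab l palette).

(** [None] marks equal points, so coarse labels also determine which points coincide. *)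
Definition coarse m x y : option (label l palette) :=
  if x == y then None else Some ((lab x y).1, tone_trunc m (lab x y).2).

Lemma coarse_sym m x y : coarse m x y = coarse m y x.
Proof. by rewrite /coarse eq_sym lab_sym. Qed.

Lemma coarse_eq m x y x' y' : coarse m x y = coarse m x' y' ->
  (x == y) = (x' == y').
Proof. by rewrite /coarse; case: (x == y); case: (x' == y'). Qed.

Lemma coarse_mono m m' x y x' y' : m <= m' ->
  coarse m' x y = coarse m' x' y' -> coarse m x y = coarse m x' y'.
Proof.
move=> le_mm'; rewrite /coarse; case: (x == y); case: (x' == y') => //= -[-> eq_t]; congr (Some (_, _)).
have truncE (a : tone palette.+1) : tone_trunc m a = tone_trunc m (tone_trunc m' a).
  case: a => [[i k]|] //=; case: ifP => [lt_im|ge_im].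
    by rewrite (leq_trans lt_im le_mm') /= lt_im.
  by case: ifP => //= _; rewrite ge_im.
by rewrite truncE eq_t -truncE.
Qed.

Definition limit_free x y := (x == y) || ((lab x y).2 != None).

(** [P] is a finite partial map preserving coarse labels, to be extended to [u]. If [u] is new, its
    edges are copied, with every forgotten tone lowered to level [m] and given a fresh hue, a
    different one for each edge. The triangles stay admissible and [lab_extension] realizes the
    result, free of limit tones. *)
Lemma coarse_step m (P : seq (nat * nat)) u : size P <= l ->
  {in P &, forall q q', coarse m q.1 q'.1 = coarse m q.2 q'.2} ->
  exists v, {in P, forall q, coarse m u q.1 = coarse m v q.2} /\
    ((u, v) \in P \/ {in P, forall q, limit_free v q.2}).
Proof.
move=> le_Pl cP.
have [/hasP[[x y] /= qP /eqP eq_u]|/hasPn newu] :=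
    boolP (has (fun q => q.1 == u) P).
  exists y; split; last by left; rewrite -eq_u.
  by move=> q' q'P; rewrite -eq_u; exact: (cP (x, y)).
pose T := [seq q.2 | q <- P].
(* The inverse of the partial map, which is injective because coarse labels detect equality. *)
pose pre y := (nth (0, 0) P (index y T)).1.
have pre_in y : y \in T -> (pre y, y) \in P.
  move=> yT; have lt_iP : index y T < size P by rewrite -(size_map snd) index_mem.
  have := mem_nth (0, 0) lt_iP; rewrite /pre.
  have : (nth (0, 0) P (index y T)).2 = y by rewrite -(nth_map _ 0) // nth_index.
  by case: nth => a b /= ->.
have preE q : q \in P -> pre q.2 = q.1.
  move=> qP; have yT : q.2 \in T by apply: map_f.
  by apply/eqP; rewrite (coarse_eq (cP _ _ (pre_in _ yT) qP)) /=.
(* The hues of all tones occurring in the triangles to be checked: at most [l] from the edges at [u]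
   and [l * l] from those inside [T]. *)
pose used := pmap (fun a => omap snd a)
  ([seq (lab u (pre y)).2 | y <- T] ++ [seq (lab y y').2 | y <- T, y' <- T]).
have le_Tl : size T <= l by rewrite size_map.
have le_used : size used + l <= palette.+1.
  rewrite ltnW // ltnS leq_add2r size_pmap (leq_trans (count_size _ _)) //.
  by rewrite size_cat size_map size_allpairs leq_add // leq_mul.
have [g [g_fresh g_inj]] := fresh_injection le_used.
pose hue y := g (index y T).
have hueP y a : y \in T ->
    a \in [seq (lab u (pre y)).2 | y <- T] ++ [seq (lab y y').2 | y <- T, y' <- T] ->
    tone_diff a (Some (m, hue y)).
  move=> yT aU; case: a aU => [[i k]|] //= aU.
  have lt_y : index y T < l by rewrite (leq_trans _ le_Tl) // index_mem.
  apply: contraNneq (g_fresh _ lt_y) => eq_k.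
  by rewrite mem_pmap; apply/mapP; exists (Some (i, k)); rewrite //= eq_k.
have hue_inj y y' : y \in T -> y' \in T -> y != y' -> hue y != hue y'.
  move=> yT y'T; apply: contraNneq => /g_inj eq_i.
  have : index y T = index y' T.
    by apply: eq_i; rewrite (leq_trans _ le_Tl) // index_mem.
  by move/(congr1 (nth 0 T)); rewrite !nth_index // => ->.
pose f y := ((lab u (pre y)).1, tone_lower m (hue y) (lab u (pre y)).2).
have [||v vP] := @lab_extension l palette T f => //.
  move=> y y' yT y'T ne_yy'.
  have uq q : q \in P -> u != q.1 by move=> qP; rewrite eq_sym; apply: newu.
  have := cP _ _ (pre_in _ yT) (pre_in _ y'T); rewrite /= /coarse (negPf ne_yy').
  case: eqVneq => // ne_pre [eq_sh eq_tone].
  rewrite /label_ok /= -eq_sh; apply/implyP=> shades.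
  apply: (tone_ok_lower eq_tone); first exact: hue_inj.
    move=> d; rewrite !inE => d3.
    have dU : d \in [seq (lab u (pre y)).2 | y <- T] ++ [seq (lab y y').2 | y <- T, y' <- T].
      rewrite mem_cat; case/or3P: d3 => /eqP->; apply/orP.
      - by left; apply: (map_f (fun y => (lab u (pre y)).2)).
      - by left; apply: (map_f (fun y => (lab u (pre y)).2)).
      - by right; apply: (allpairs_f (fun y y' => (lab y y').2)).
    by rewrite !hueP.
  have ok3 : label_ok (lab u (pre y)) (lab u (pre y')) (lab (pre y) (pre y')).
    rewrite lab_sym; apply: lab_triangle => //; last exact: uq (pre_in _ y'T).
    by rewrite eq_sym; exact: uq (pre_in _ yT).
  by move/implyP: ok3; apply.
exists v; split=> [q qP|].
  have [ne_v eq_v] := vP _ (map_f snd qP).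
  have ne_u : u != q.1 by rewrite eq_sym; apply: newu.
  rewrite /coarse (negPf ne_u) (negPf ne_v) eq_v /f /= preE //.
  congr (Some (_, _)); rewrite /tone_lower /tone_trunc.
  by case: (lab u q.1).2 => [[i k]|] /=; [case: ifP => /= [->|]|]; rewrite ?ltnn.
right=> q qP; have [_ eq_v] := vP _ (map_f snd qP).
rewrite /limit_free eq_v /f /tone_lower /=; apply/orP; right.
by case: (lab u (pre q.2)).2 => [[i k]|] /=; [case: ifP|].
Qed.

Lemma coarse_forth (I : eqType) (r : seq I) m (s t : I -> nat) u : size r <= l ->
  {in r &, forall i j, coarse m (s i) (s j) = coarse m (t i) (t j)} ->
  exists v, {in r, forall i, coarse m u (s i) = coarse m v (t i)}.
Proof.
move=> le_rl st; have [||v [vP _]] := @coarse_step m [seq (s i, t i) | i <- r] u.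
- by rewrite size_map.
- by move=> q q' /mapP[i ir ->] /mapP[j jr ->]; exact: st.
by exists v => i ir; apply: (vP (s i, t i)); apply: map_f.
Qed.

Lemma fo_free_vars n k (f : fo_formula n k) : {subset fo_free f <= fo_vars f}.
Proof.
elim: f => [r x|x y|f IHf|f IHf g IHg|x f IHf] //= z.
  by rewrite !mem_cat => /orP[/IHf->|/IHg->]; rewrite ?orbT.
by rewrite mem_filter inE => /andP[_ /IHf->]; rewrite orbT.
Qed.

Definition invariant_at n m (X : set ('I_n -> nat)) :=
  forall s t, (forall i j, coarse m (s i) (s j) = coarse m (t i) (t j)) -> X s -> X t.

(** At a quantifier, [coarse_forth] moves the witness; at most [l] points must be respected, since
    the free variables are distinct numbers below [l]. The level [m] is the same before and after
    the move, so quantifiers cost no precision. *)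
Lemma fo_sat_invariant n k m (X : 'I_k -> set ('I_n -> nat)) (f : fo_formula n k) :
  (forall r, invariant_at m (X r)) -> (forall x, x \in fo_vars f -> x < l) ->
  forall s t, {in fo_free f &, forall i j, coarse m (s i) (s j) = coarse m (t i) (t j)} ->
  fo_sat X f s <-> fo_sat X f t.
Proof.
move=> invX; elim: f => [r x|x y|f IHf|f IHf g IHg|x f IHf] /= lt_l s t st.
- by split; apply: invX => i j; rewrite ?st ?mem_tnth.
- have := coarse_eq (st x y _ _); rewrite !inE !eqxx orbT => /(_ isT isT) eqE.
  by split=> /eqP; [rewrite eqE|rewrite -eqE] => /eqP.
- by have := IHf lt_l _ _ st; tauto.
- have stl : fo_sat X f s <-> fo_sat X f t.
    apply: IHf => [x xf|x y xf yf]; first by rewrite lt_l // mem_cat xf.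
    by rewrite st // mem_cat ?xf ?yf.
  have str : fo_sat X g s <-> fo_sat X g t.
    apply: IHg => [x xf|x y xf yf]; first by rewrite lt_l // mem_cat xf orbT.
    by rewrite st // mem_cat ?xf ?yf orbT.
  by tauto.
- have half (s' t' : nat -> nat) :
      {in [seq y <- fo_free f | y != x] &, forall i j,
        coarse m (s' i) (s' j) = coarse m (t' i) (t' j)} ->
      (exists u, fo_sat X f [eta s' with x |-> u]) ->
      exists u, fo_sat X f [eta t' with x |-> u].
    move=> st' [u sat_u]; pose r := undup [seq y <- fo_free f | y != x].
    have [||v vP] := @coarse_forth _ r m s' t' u.
    - rewrite -(size_iota 0 l) uniq_leq_size ?undup_uniq // => y.
      rewrite mem_undup mem_filter mem_iota add0n => /andP[_ yf].
      by rewrite lt_l // inE fo_free_vars ?orbT.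
    - by move=> i j; rewrite !mem_undup; exact: st'.
    exists v; apply: (proj1 (IHf _ [eta s' with x |-> u] _ _)) sat_u => [y yf|].
      by rewrite lt_l // inE yf orbT.
    move=> i j fi fj /=.
    have inr y : y \in fo_free f -> y != x -> y \in r.
      by move=> ? ?; rewrite mem_undup mem_filter; apply/andP.
    case: eqVneq => [_|ne_ix]; case: eqVneq => [_|ne_jx].
    - by rewrite /coarse !eqxx.
    - by apply: vP; exact: inr.
    - by rewrite coarse_sym (coarse_sym _ (t' i)); apply: vP; exact: inr.
    - by apply: st'; rewrite -mem_undup; exact: inr.
  by split; apply: half => // i j ir jr; rewrite st.
Qed.

Lemma fo_op_invariant n k m (X : 'I_k -> set ('I_n -> nat)) (f : fo_formula n k) :
  (forall r, invariant_at m (X r)) -> (forall x, x \in fo_vars f -> x < l) ->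
  (forall x, x \in fo_free f -> x < n) -> invariant_at m (fo_op f X).
Proof.
move=> invX lt_l lt_n s t st [s' s'E sat_s'].
(* The default 0 is seen only by variables that are not free in [f]. *)
pose t' i := if insub i is Some j then t j else 0.
exists t'; first by move=> i; rewrite /t' valK.
apply: (proj1 (fo_sat_invariant invX lt_l _)) sat_s' => x y /lt_n lt_xn /lt_n lt_yn.
by rewrite /t' (insubT (fun i => i < n) lt_xn) (insubT (fun i => i < n) lt_yn) -st -!s'E.
Qed.

Lemma cyl_invariant n m (X : set ('I_n -> nat)) i : n <= l -> invariant_at m X ->
  invariant_at m [set s | exists2 t, X t & forall j, j != i -> s j = t j]%classic.
Proof.
move=> le_nl invX s t st [s' Xs' s'E].
have [||v vP] := @coarse_forth _ (enum 'I_n) m s t (s' i).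
- by rewrite size_enum_ord.
- by move=> j k _ _; exact: st.
exists [eta t with i |-> v]; last by move=> j /= /negPf->.
apply: invX Xs' => j k /=.
case: (eqVneq j i) => [->|/s'E <-]; case: (eqVneq k i) => [->|/s'E <-] //.
- by rewrite /coarse !eqxx.
- by apply: vP; rewrite mem_enum.
- by rewrite coarse_sym (coarse_sym _ (t j)); apply: vP; rewrite mem_enum.
Qed.

End Coarse.

(** * The Boolean algebra of definable sets *)

Section DefinableSets.
Variables l n : nat.

Definition definable (X : set ('I_n -> nat)) := exists m, invariant_at l m X.

Lemma definable_uniform (k : nat) (X : 'I_k -> set ('I_n -> nat)) :
  (forall r, definable (X r)) -> exists m, forall r, invariant_at l m (X r).
Proof.
move=> /choice[m mP]; exists (\max_r m r) => r s t st.
by apply: mP => i j; apply: coarse_mono (st i j); exact: leq_bigmax.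
Qed.

Lemma definableI X Y : definable X -> definable Y -> definable (X `&` Y).
Proof.
move=> [m mX] [m' mY]; exists (maxn m m') => s t st [Xs Ys].
split; [apply: mX Xs|apply: mY Ys] => i j; apply: coarse_mono (st i j).
  exact: leq_maxl.
exact: leq_maxr.
Qed.

Lemma definableC X : definable X -> definable (~` X).
Proof. by move=> [m mX]; exists m => s t st nXs Xt; apply: nXs; apply: mX Xt. Qed.

Lemma definableU X Y : definable X -> definable Y -> definable (X `|` Y).
Proof.
move=> dX dY; rewrite -(setCK (X `|` Y)) setCU; apply: definableC.
by apply: definableI; exact: definableC.
Qed.

Lemma definable0 : definable set0.
Proof. by exists 0. Qed.

Lemma definableT : definable setT.
Proof. by exists 0. Qed.

Definition definable_set := {X : set ('I_n -> nat) | `[< definable X >]}.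

Definition def_set X (dX : definable X) : definable_set := exist _ X (asboolT dX).

Lemma definable_val (x : definable_set) : definable (val x).
Proof. by apply/asboolP; exact: (valP x). Qed.

HB.instance Definition _ := Choice.on definable_set.

Definition def_meet (x y : definable_set) :=
  def_set (definableI (definable_val x) (definable_val y)).
Definition def_join (x y : definable_set) :=
  def_set (definableU (definable_val x) (definable_val y)).
Definition def_compl (x : definable_set) := def_set (definableC (definable_val x)).
Definition def_le (x y : definable_set) := def_meet x y == x.
Definition def_lt (x y : definable_set) := (y != x) && def_le x y.

Fact def_display : Order.disp_t. Proof. by []. Qed.

Let meetC : commutative def_meet. Proof. by move=> x y; apply: val_inj; exact: setIC. Qed.
Let joinC : commutative def_join. Proof. by move=> x y; apply: val_inj; exact: setUC. Qed.
Let meetA : associative def_meet. Proof. by move=> x y z; apply: val_inj; exact: setIA. Qed.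
Let joinA : associative def_join. Proof. by move=> x y z; apply: val_inj; exact: setUA. Qed.
Let joinKI y x : def_meet x (def_join x y) = x.
Proof. by apply: val_inj; rewrite /= setUC setKU. Qed.
Let meetKU y x : def_join x (def_meet x y) = x.
Proof. by apply: val_inj; rewrite /= setIC setKI. Qed.
Let meetUl : left_distributive def_meet def_join.
Proof. by move=> x y z; apply: val_inj; exact: setIUl. Qed.
Let meetxx : idempotent_op def_meet. Proof. by move=> x; apply: val_inj; exact: setIid. Qed.

HB.instance Definition _ := Order.isMeetJoinDistrLattice.Build def_display
  definable_set (fun x y => erefl (def_le x y)) (fun x y => erefl (def_lt x y))
  meetC joinC meetA joinA joinKI meetKU meetUl meetxx.

Let def0x x : (def_set definable0 <= x)%O.
Proof. by apply/eqP/val_inj; exact: set0I. Qed.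
Let defxT x : (x <= def_set definableT)%O.
Proof. by apply/eqP/val_inj; exact: setIT. Qed.

HB.instance Definition _ := Order.hasBottom.Build def_display definable_set def0x.
HB.instance Definition _ := Order.hasTop.Build def_display definable_set defxT.

Let joinxC x : def_join x (def_compl x) = def_set definableT.
Proof. by apply: val_inj; exact: setUv. Qed.
Let meetxC x : def_meet x (def_compl x) = def_set definable0.
Proof. by apply: val_inj; exact: setICr. Qed.

HB.instance Definition _ := Order.TBDistrLattice_hasComplement.Build def_display
  definable_set joinxC meetxC.

Lemma def_leP (x y : definable_set) : reflect (val x `<=` val y) (x <= y)%O.
Proof.
apply: (iffP eqP) => [/(congr1 val)/setIidPl//|/setIidPl xy].
exact: val_inj.
Qed.

Lemma def_neq0 (x : definable_set) : x != Order.bottom -> exists t, val x t.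
Proof.
move=> x_n0; apply: contrapT => no; case/eqP: x_n0; apply: val_inj => /=.
by apply/seteqP; split=> t // xt; case: no; exists t.
Qed.

Lemma def_neq0P (x : definable_set) t : val x t -> x != Order.bottom.
Proof. by move=> xt; apply: contraTneq isT => x0; move: xt; rewrite x0. Qed.

End DefinableSets.

(** * Atoms are the limit-free types *)

Section AtomsOfDefinableSets.
Variables l n : nat.
Hypothesis lt_nl : n < l.

Notation lab := (@lab l (palette l)).
Implicit Types s t : 'I_n -> nat.

Definition same_type s t :=
  forall i j, (s i == s j) = (t i == t j) /\ (s i != s j -> lab (s i) (s j) = lab (t i) (t j)).

Definition limit_free_tuple t := forall i j, limit_free l (t i) (t j).

Lemma same_typeC s t : same_type s t -> same_type t s.
Proof.
move=> st i j; have [eqE labE] := st i j; split=> //.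
by rewrite -eqE => /labE.
Qed.

Lemma same_type_coarse m s t : same_type s t ->
  forall i j, coarse l m (s i) (s j) = coarse l m (t i) (t j).
Proof.
move=> st i j; have [eqE labE] := st i j; rewrite /coarse -eqE.
by case: eqVneq labE => // _ ->.
Qed.

Lemma same_type_definable (X : set ('I_n -> nat)) s t : definable l X ->
  same_type s t -> X s -> X t.
Proof. by move=> [m mX] st; apply: mX; exact: same_type_coarse. Qed.

(** Truncation just above the finitely many levels occurring in [t] forgets none of its tones, so
    the coarse type is already the full type. *)
Lemma limit_free_isolated t : limit_free_tuple t -> exists m, forall s,
  (forall i j, coarse l m (t i) (t j) = coarse l m (s i) (s j)) -> same_type t s.
Proof.
move=> t_lf; pose lev i j := if (lab (t i) (t j)).2 is Some x then x.1 else 0.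
exists (\max_i \max_j lev i j).+1 => s ts i j; have eqE := coarse_eq (ts i j).
split=> // ne_t; have := ts i j; have := t_lf i j.
rewrite /limit_free /coarse -eqE (negPf ne_t) /=.
have : lev i j < (\max_i \max_j lev i j).+1.
  by rewrite ltnS (leq_trans _ (leq_bigmax i)) // (leq_trans _ (leq_bigmax j)).
move: (\max_i \max_j _).+1 => m; rewrite /lev.
case: (lab (t i) (t j)) => d [[h k]|] //= lt_hm _; rewrite lt_hm.
case: (lab (s i) (s j)) => d' [[h' k']|] //= [->]; by case: ifP => // _ [-> ->].
Qed.

Lemma limit_free_approx m s : exists2 t, limit_free_tuple t &
  forall i j, coarse l m (s i) (s j) = coarse l m (t i) (t j).
Proof.
(* The points are copied one by one with [coarse_step], which needs at most [l] earlier pairs; hence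
   the bound [l.+1]. *)
have build (S : seq nat) : size S <= l.+1 -> exists P : seq (nat * nat),
    [/\ unzip1 P = S, {in P &, forall q q', coarse l m q.1 q'.1 = coarse l m q.2 q'.2}
      & {in P &, forall q q', limit_free l q.2 q'.2}].
  elim: S => [|u S IHS] le_Sl; first by exists [::]; split.
  have [|P [PS cP lfP]] := IHS; first exact: ltnW.
  have [||v [cv lfv]] := @coarse_step l m P u.
  - by rewrite -(size_map fst) -/unzip1 PS.
  - exact: cP.
  have {}lfv : {in P, forall q, limit_free l v q.2}.
    by case: lfv => // uvP q qP; exact: (lfP (u, v)).
  exists ((u, v) :: P); split=> [|q q'|q q']; rewrite /= ?PS // !inE.
  - case/predU1P=> [->|qP] /predU1P[->|q'P] /=; rewrite ?cv //.
    + by rewrite /coarse !eqxx.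
    + by rewrite coarse_sym cv // coarse_sym.
    + exact: cP.
  - case/predU1P=> [->|qP] /predU1P[->|q'P] /=.
    + by rewrite /limit_free eqxx.
    + exact: lfv.
    + by rewrite /limit_free eq_sym lab_sym; exact: lfv.
    + exact: lfP.
have [|P [PS cP lfP]] := build [seq s i | i <- enum 'I_n].
  by rewrite size_map size_enum_ord ltnW // ltnW.
have /choice[t tP] : forall i, exists y, (s i, y) \in P.
  move=> i; have : s i \in unzip1 P by rewrite PS; apply: map_f; rewrite mem_enum.
  by case/mapP=> [[x y] qP /= ->]; exists y.
exists t => i j; first exact: (lfP _ _ (tP i) (tP j)).
exact: (cP _ _ (tP i) (tP j)).
Qed.

Notation set_alg := (definable_set l n).

Lemma type_definable t : limit_free_tuple t -> definable l [set s | same_type t s].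
Proof.
move=> /limit_free_isolated[m mP]; exists m => s s' ss' ts.
by apply: mP => i j; rewrite -ss'; exact: same_type_coarse.
Qed.

Definition type_set t (t_lf : limit_free_tuple t) : set_alg :=
  def_set (type_definable t_lf).

Lemma same_type_refl t : same_type t t.
Proof. by []. Qed.

Lemma type_set_atom t (t_lf : limit_free_tuple t) : is_atom (type_set t_lf).
Proof.
split; first by apply: (@def_neq0P _ _ _ t); exact: same_type_refl.
move=> b /def_leP /= ble; have [->|/def_neq0[s bs]] := eqVneq b Order.bottom; first by left.
right; apply: val_inj; apply/seteqP; split=> //= s' ts'.
apply: same_type_definable (definable_val b) _ (bs) => i j.
have [eqE labE] := ble _ bs i j; have [eqE' labE'] := ts' i j.
by rewrite -eqE -eqE'; split=> // ne_t; rewrite -labE // -labE'.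
Qed.

(** A nonempty definable set contains a limit-free tuple, by [limit_free_approx], and then its whole
    type. By minimality the atom is that type. *)
Lemma atomP (a : set_alg) t : is_atom a -> val a t -> 
  limit_free_tuple t /\ forall s, val a s -> same_type t s.
Proof.
move=> [a_n0 a_min]; have [m mP] := definable_val a; have [s as_] := def_neq0 a_n0.
have [t0 t0_lf st0] := limit_free_approx m s.
have at0 : val a t0 by exact: mP st0 as_.
have aE : type_set t0_lf = a.
  have [||//] := a_min (type_set t0_lf).
    by apply/def_leP => s' /same_type_definable; apply=> //; exact: definable_val.
  by move=> t00; have := type_set_atom t0_lf; rewrite t00 => -[/eqP].
rewrite -aE /= => t0t; split=> [i j|s' t0s' i j].
  have [eqE labE] := t0t i j; have := t0_lf i j; rewrite /limit_free -eqE.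
  by case: eqVneq labE => //= _ ->.
have [eqE labE] := t0t i j; have [eqE' labE'] := t0s' i j.
by rewrite -eqE -eqE'; split=> // ne_t; rewrite -labE // -labE'.
Qed.

Lemma definable_atomic : atomic set_alg.
Proof.
move=> x /def_neq0[s xs]; have [m mP] := definable_val x.
have [t t_lf st] := limit_free_approx m s; exists (type_set t_lf); first exact: type_set_atom.
apply/def_leP => s' ts'; apply: same_type_definable (definable_val x) ts' _.
exact: mP xs.
Qed.

End AtomsOfDefinableSets.

(** * The expanded set algebra of definable sets *)

Section DefinableAlgebra.
Variables (n l : nat) (E : fo_expansion n).
Hypothesis lt_nl : n < l.
Hypothesis lt_vars : forall (o : op_sym E) (x : nat), x \in fo_vars (op_def o) -> x < l.

Lemma definable_cyl i (x : definable_set l n) :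
  definable l (@cyl n E (full_set_alg E nat) i (val x)).
Proof. by have [m mX] := definable_val x; exists m; apply: cyl_invariant (ltnW lt_nl) mX. Qed.

Lemma definable_diag i j : definable l (diag (full_set_alg E nat) i j).
Proof.
by exists 0 => s t st /= /eqP; rewrite (coarse_eq (st i j)) => /eqP.
Qed.

Lemma definable_ext o (x : 'I_(op_ar o) -> definable_set l n) :
  definable l (ext (full_set_alg E nat) o (fun r => val (x r))).
Proof.
have [m mX] := definable_uniform (fun r => definable_val (x r)).
exists m; apply: (fo_op_invariant mX); [exact: lt_vars|exact: op_free].
Qed.

Definition definable_alg : cyl_alg E := @CylAlg n E _ (definable_set l n)
  (fun i x => def_set (definable_cyl i x)) (fun i j => def_set (definable_diag i j))
  (fun o x => def_set (definable_ext x)).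

Lemma definable_alg_RCA : RCA_plus definable_alg.
Proof.
exists unit, (fun=> nat), (fun _ (x : definable_set l n) => val x); split; last first.
  by move=> x y /(_ tt)/val_inj.
by move=> _; split=> // x; rewrite complEset.
Qed.

End DefinableAlgebra.

(** * Ramsey's theorem for triangles *)

Lemma pigeonhole (I C : eqType) (f : I -> C) m (cs : seq C) (r : seq I) :
  {in r, forall i, f i \in cs} -> size cs * m < size r ->
  exists2 c, c \in cs & m < size [seq i <- r | f i == c].
Proof.
elim: cs r => [|c cs IHcs] r fr /= lt_r.
  by case: r fr lt_r => // i r /(_ i (mem_head _ _)).
have [|le_m] := ltnP m (size [seq i <- r | f i == c]).
  by exists c => //; exact: mem_head.
have [||c' c'cs lt_m] := IHcs [seq i <- r | f i != c].
- move=> i; rewrite mem_filter => /andP[ne_c /fr].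
  by rewrite inE (negPf ne_c).
- rewrite size_filter -(ltn_add2l m) -mulSn (leq_trans lt_r) //.
  by rewrite -(count_predC (fun i => f i == c) r) leq_add2r -size_filter.
exists c'; first by rewrite inE c'cs orbT.
rewrite (leq_trans lt_m) // -filter_predI !size_filter; apply: sub_count => i /=.
by case/andP.
Qed.

Lemma ramsey_triangle (I C : eqType) (col : I -> I -> C) p : exists m,
  forall (cs : seq C) (r : seq I), size cs <= p -> m <= size r -> uniq r ->
  {in r &, forall i j, i != j -> col i j \in cs} ->
  exists i j k, [/\ [&& i != j, j != k & i != k], col i j = col j k & col i j = col i k].
Proof.
elim: p => [|p [m IHm]].
  exists 2 => -[|//] [|i [|j r]] //= _ _ /and3P[+ _ _] colr.
  rewrite inE negb_or => /andP[ne_ij _].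
  by have := colr i j; rewrite !inE !eqxx orbT => /(_ isT isT ne_ij).
(* Without [x] more than [p.+1 * m] points remain, so more than [m] of them get the same colour from
   [x]. *)
exists (p.+1 * m).+2 => cs [|x r] // le_cs le_r /= /andP[xr r_uniq] colr.
have [||c c_cs lt_m] := @pigeonhole _ _ (col x) m cs r.
- move=> i ir; apply: colr; rewrite ?inE ?eqxx ?ir ?orbT //.
  by apply: contraNneq xr => ->.
- by apply: leq_ltn_trans (le_r : p.+1 * m < size r); rewrite leq_mul2r le_cs orbT.
set r' := [seq i <- r | _] in lt_m.
have r'P i : i \in r' -> [/\ i \in r, x != i & col x i = c].
  rewrite mem_filter => /andP[/eqP <- ir]; split=> //.
  by apply: contraNneq xr => ->.
have [[i [j [ir' jr' ne_ij col_ij]]]|no] :=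
    pselect (exists i j, [/\ i \in r', j \in r', i != j & col i j = c]).
  have [[_ ne_xi col_xi] [_ ne_xj col_xj]] := (r'P _ ir', r'P _ jr').
  by exists x, i, j; rewrite ne_xi ne_ij ne_xj col_xi col_xj col_ij.
apply: (IHm (rem c cs) r').
- by rewrite size_rem //; case: (cs) le_cs.
- exact: ltnW.
- exact: filter_uniq.
move=> i j ir' jr' ne_ij; have [[ir _ _] [jr _ _]] := (r'P _ ir', r'P _ jr').
have := colr i j; rewrite !inE ir jr !orbT => /(_ isT isT ne_ij).
have ne_c : col i j != c by apply/eqP=> col_ij; apply: no; exists i, j.
by rewrite (perm_mem (perm_to_rem c_cs)) inE (negPf ne_c).
Qed.

(** * The complex algebra is not representable *)

Section CompletionNotRepresentable.
Variables (n l : nat) (E : fo_expansion n).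
Hypothesis n_gt2 : 2 < n.
Hypothesis lt_nl : n < l.
Hypothesis lt_vars : forall (o : op_sym E) (x : nat), x \in fo_vars (op_def o) -> x < l.

Notation lab := (@lab l (palette l)).
Notation alg := (definable_alg lt_nl lt_vars).
Notation completion := (Cm (At alg)).

Definition mem_atom (a : At alg) (t : 'I_n -> nat) : Prop :=
  val (sval a : definable_set l n) t.

Lemma mem_atomP (a : At alg) t : mem_atom a t ->
  limit_free_tuple l t /\ forall s, mem_atom a s -> same_type l t s.
Proof. exact: (atomP lt_nl (svalP a)). Qed.

Lemma mem_atomE (a : At alg) : exists t, mem_atom a t.
Proof. by case: (svalP a) => /def_neq0. Qed.

(** The complex algebra contains every set of atoms, so [Q] may constrain infinitely many levels at
    once and need not be definable. *)
Definition edge (i j : 'I_n) (Q : label l (palette l) -> Prop) : completion :=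
  [set a | exists t, [/\ mem_atom a t, t i != t j & Q (lab (t i) (t j))]].

Lemma edgeP i j Q a : edge i j Q a ->
  forall t, mem_atom a t -> t i != t j /\ Q (lab (t i) (t j)).
Proof.
move=> [s [as_ ne_s Qs]] t at_; have [_ /(_ _ at_ i j)[eqE labE]] := mem_atomP as_.
by rewrite -eqE -labE.
Qed.

Lemma cyl_atomP k (X : completion) a t : cyl k X a -> mem_atom a t ->
  exists b t', [/\ X b, mem_atom b t' & forall j, j != k -> t j = t' j].
Proof.
by move=> [b Xb /def_leP ab] /ab[t' bt' eqt]; exists b, t'.
Qed.

Lemma cyl_edge k i j Q : i != k -> j != k ->
  (cyl k (edge i j Q) : set (At alg)) `<=` edge i j Q.
Proof.
move=> ne_ik ne_jk a; have [t at_] := mem_atomE a.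
move=> /cyl_atomP/(_ at_)[b [t' [eb bt' eqt]]].
have [ne_t Qt] := edgeP eb bt'.
by exists t; rewrite !eqt.
Qed.

(** The left side is the cylindric term for substituting coordinate [j'] for [j]. Being an inclusion
    between terms, the property passes to every homomorphic image. *)
Lemma cyl_edge_r i j j' Q : i != j -> j' != j ->
  (cyl j (Order.meet (diag completion j j') (edge i j Q)) : set (At alg)) `<=` edge i j' Q.
Proof.
move=> ne_ij ne_j'j a; have [t at_] := mem_atomE a.
move=> /cyl_atomP/(_ at_)[b [t' [[db eb] bt' eqt]]].
have [ne_t Qt] := edgeP eb bt'.
have /def_leP/(_ _ bt') /= eq_t' : (sval b <= diag alg j j')%O := db.
by exists t; rewrite !eqt // -eq_t'.
Qed.

Lemma cyl_edge_l i i' j Q : j != i -> i' != i ->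
  (cyl i (Order.meet (diag completion i i') (edge i j Q)) : set (At alg)) `<=` edge i' j Q.
Proof.
move=> ne_ji ne_i'i a; have [t at_] := mem_atomE a.
move=> /cyl_atomP/(_ at_)[b [t' [[db eb] bt' eqt]]].
have [ne_t Qt] := edgeP eb bt'.
have /def_leP/(_ _ bt') /= eq_t' : (sval b <= diag alg i i')%O := db.
by exists t; rewrite !eqt // -eq_t'.
Qed.

Let o0 : 'I_n := Ordinal (ltnW (ltnW n_gt2)).
Let o1 : 'I_n := Ordinal (ltnW n_gt2).
Let o2 : 'I_n := Ordinal n_gt2.

Definition hue_class (c : 'I_l.+1 * 'I_(palette l).+1) (a : label l (palette l)) :=
  a.1 = c.1 /\ exists i, a.2 = Some (i, c.2).

Definition level_label (i : nat) : label l (palette l) := (ord0, Some (i, ord0)).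

Lemma hue_class_triangle c a a' a'' : label_ok a a' a'' ->
  hue_class c a -> hue_class c a' -> hue_class c a'' -> False.
Proof.
case: a a' a'' => [d x] [d' x'] [d'' x''] ok [/= d_c [i x_i]] [/= d_c' [i' x_i']].
case=> [/= d_c'' [i'' x_i'']]; move: ok; rewrite d_c d_c' d_c'' x_i x_i' x_i''.
by rewrite /label_ok /tone_ok /tone_ok3 /= !eqxx /= !andbF.
Qed.

Lemma edge_triangle c :
  edge o0 o1 (hue_class c) `&` edge o1 o2 (hue_class c) `&` edge o0 o2 (hue_class c) = set0.
Proof.
apply/seteqP; split=> // a [[e01 e12] e02]; have [t at_] := mem_atomE a.
have [[ne01 Q01] [ne12 Q12]] := (edgeP e01 at_, edgeP e12 at_).
have [ne02 Q02] := edgeP e02 at_.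
exact: hue_class_triangle (lab_triangle _ _ ne01 ne12 ne02) Q01 Q12 Q02.
Qed.

(** Atoms are limit-free, so each of their edges has a genuine hue. Thus finitely many hue classes
    cover all edges. *)
Lemma diag_or_edge (a : At alg) : 
  (diag completion o0 o1 : set (At alg)) a \/ exists c, edge o0 o1 (hue_class c) a.
Proof.
have [t at_] := mem_atomE a; have [t_lf ta] := mem_atomP at_.
have [eq_t|ne_t] := eqVneq (t o0) (t o1).
  left; apply/def_leP => s /ta/(_ o0 o1)[eqE _]; apply/eqP.
  by rewrite -eqE eq_t.
right; have := t_lf o0 o1; rewrite /limit_free (negPf ne_t) /=.
case lab_t: (lab (t o0) (t o1)) => [d [[i k]|]] // _.
by exists (d, k), t; rewrite lab_t; split=> //; split=> //; exists i.
Qed.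

Lemma cyl_edge_level i :
  (cyl o1 (edge o0 o1 (eq^~ (level_label i))) : set (At alg)) = setT.
Proof.
apply/seteqP; split=> // a _; have [t at_] := mem_atomE a.
have [t_lf ta] := mem_atomP at_.
pose T := t o0 :: [seq t j | j <- enum 'I_n].
(* Distinct shades for distinct points make every triangle at the new point admissible. The point
   [t o0] heads [T], so its edge has shade [ord0], as [level_label] requires. *)
pose f y : label l (palette l) := (inord (index y T), Some (i, ord0)).
have le_Tl : size T <= l by rewrite /= size_map size_enum_ord.
have tT j : t j \in T by rewrite inE (map_f t) ?orbT // mem_enum.
have [||v vP] := @lab_extension l (palette l) T f => //.
  move=> x y xT yT ne_xy; apply/implyP=> /andP[/eqP/(congr1 val) + _].
  have lt_i z : z \in T -> index z T < l.+1.
    by move=> zT; rewrite ltnW // ltnS (leq_trans _ le_Tl) // index_mem.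
  rewrite /= !inordK ?lt_i // => /(congr1 (nth 0 T)); rewrite !nth_index // => eq_xy.
  by rewrite eq_xy eqxx in ne_xy.
pose t' j := if j == o1 then v else t j.
have t'_lf : limit_free_tuple l t'.
  move=> j k; rewrite /t'; case: (eqVneq j o1) => _; case: (eqVneq k o1) => _.
  - by rewrite /limit_free eqxx.
  - by have [ne_v lab_v] := vP _ (tT k); rewrite /limit_free lab_v orbT.
  - by have [ne_v lab_v] := vP _ (tT j); rewrite /limit_free lab_sym lab_v orbT.
  - exact: t_lf.
exists (exist _ (type_set t'_lf) (type_set_atom t'_lf)).
  exists t'; split; [exact: same_type_refl| |];
    rewrite /t' /=; have [ne_v lab_v] := vP _ (tT o0).
    by rewrite eq_sym.
  rewrite lab_sym lab_v /f /= eqxx /level_label; congr (_, _).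
  by apply: ord_inj; rewrite inordK.
apply/def_leP => s /ta ts.
(* The cylinder over the new type is definable, so once it contains [t] it contains the whole type
   of [t]. *)
have ct : (@cyl n E (full_set_alg E nat) o1 [set s | same_type l t' s]) t.
  by exists t'; [exact: same_type_refl|move=> j /negPf ne_j; rewrite /t' ne_j].
have cs := same_type_definable (definable_cyl E lt_nl o1 (type_set t'_lf)) ts ct.
exact: cs.
Qed.

(** * A nontrivial homomorphism into a full set algebra is impossible *)

Section Representation.
Variables (U : Type) (h : completion -> full_set_alg E U) (h_hom : is_hom h).
Hypothesis h_nontrivial : h setT <> h set0.

Notation img X := (h X : set ('I_n -> U)).

Definition put (s : 'I_n -> U) k u : 'I_n -> U := fun j => if j == k then u else s j.

Lemma img0 : img set0 = set0.
Proof. exact: (hom_bottom h_hom). Qed.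

Lemma imgI X Y : img (X `&` Y) = img X `&` img Y.
Proof. exact: (hom_meet h_hom). Qed.

Lemma imgU X Y : img (X `|` Y) = img X `|` img Y.
Proof. exact: (hom_join h_hom). Qed.

Lemma img_sub (X Y : completion) : (X : set (At alg)) `<=` Y -> img X `<=` img Y.
Proof. by move=> /setIidPl <-; rewrite imgI => s []. Qed.

Lemma img_cyl (X : completion) k s u : img X (put s k u) -> img (cyl k X) s.
Proof.
rewrite (hom_cyl h_hom) => Xs; exists (put s k u) => // j /negPf ne_jk.
by rewrite /put ne_jk.
Qed.

Lemma img_edge_put i j Q s k u : i != k -> j != k ->
  img (edge i j Q) (put s k u) -> img (edge i j Q) s.
Proof. by move=> ? ? /img_cyl; apply: img_sub; exact: cyl_edge. Qed.

Lemma img_edge_r i j j' Q s : i != j -> j' != j ->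
  img (edge i j Q) (put s j (s j')) -> img (edge i j' Q) s.
Proof.
move=> ne_ij ne_j'j es; apply: (img_sub (cyl_edge_r ne_ij ne_j'j (Q := Q))).
apply: (img_cyl (u := s j')); rewrite (hom_meet h_hom) (hom_diag h_hom); split=> //=.
by rewrite /put eqxx (negPf ne_j'j).
Qed.

Lemma img_edge_l i i' j Q s : j != i -> i' != i ->
  img (edge i j Q) (put s i (s i')) -> img (edge i' j Q) s.
Proof.
move=> ne_ji ne_i'i es; apply: (img_sub (cyl_edge_l ne_ji ne_i'i (Q := Q))).
apply: (img_cyl (u := s i')); rewrite (hom_meet h_hom) (hom_diag h_hom); split=> //=.
by rewrite /put eqxx (negPf ne_i'i).
Qed.

Definition joined Q (x y : U) : Prop := 
  exists s, [/\ s o0 = x, s o1 = y & img (edge o0 o1 Q) s].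

(** An edge depends on coordinates 0 and 1 only; the other coordinates are changed one at a time by
    cylindrification. *)
Lemma joinedP Q s : joined Q (s o0) (s o1) -> img (edge o0 o1 Q) s.
Proof.
move=> [s' [eq0 eq1 es']].
suff mix (r : seq 'I_n) : img (edge o0 o1 Q) (fun k => if k \in r then s k else s' k).
  have := mix (enum 'I_n); congr (img _ _).
  by apply: funext => k; rewrite mem_enum.
elim: r => [|k r IHr]; first exact: es'.
have [->|ne_k0] := eqVneq k o0.
  move: IHr; congr (img _ _); apply: funext => j; rewrite inE.
  by case: eqVneq => //= ->; rewrite eq0; case: ifP.
have [->|ne_k1] := eqVneq k o1.
  move: IHr; congr (img _ _); apply: funext => j; rewrite inE.
  by case: eqVneq => //= ->; rewrite eq1; case: ifP.
apply: (@img_edge_put _ _ _ _ k (if k \in r then s k else s' k)); rewrite 1?eq_sym //.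
move: IHr; congr (img _ _); apply: funext => j; rewrite /put inE.
by case: eqVneq => //= ->.
Qed.

(** A single tuple holds the three points in coordinates 0, 1 and 2, and substitutions move each
    edge to its pair of coordinates. There [edge_triangle] gives an empty meet. *)
Lemma no_joined_triangle c x y z : joined (hue_class c) x y ->
  joined (hue_class c) y z -> joined (hue_class c) x z -> False.
Proof.
move=> xy yz xz.
pose s (k : 'I_n) := if k == o0 then x else if k == o1 then y else z.
have e01 : img (edge o0 o1 (hue_class c)) s by exact: joinedP.
have e02 : img (edge o0 o2 (hue_class c)) s.
  by apply: (@img_edge_r o0 o1 o2) => //; exact: joinedP.
have e12 : img (edge o1 o2 (hue_class c)) s.
  apply: (@img_edge_l o0 o1 o2) => //; apply: (@img_edge_r o0 o1 o2) => //.
  exact: joinedP.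
suff : img set0 s by rewrite img0.
by rewrite -(edge_triangle c) !imgI.
Qed.

(** A homomorphism need not preserve infinite joins, but the join [J] of all hue classes is finite
    and lies above the complement of the diagonal. *)
Lemma joined_total x y : x <> y -> exists c, joined (hue_class c) x y.
Proof.
move=> ne_xy; pose s (k : 'I_n) := if k == o0 then x else y.
pose J (r : seq ('I_l.+1 * 'I_(palette l).+1)) : completion :=
  foldr (fun c X => edge o0 o1 (hue_class c) `|` X) set0 r.
have JP r a c : c \in r -> edge o0 o1 (hue_class c) a -> (J r : set (At alg)) a.
  by elim: r => //= c' r IHr; rewrite inE => /predU1P[<-|/IHr Jr] ec; [left|right; exact: Jr].
have imgJ r : img (J r) s -> exists c, img (edge o0 o1 (hue_class c)) s.
  elim: r => [|c r IHr] /=; first by rewrite img0.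
  by rewrite imgU => -[ec|/IHr//]; exists c.
have [|c ec] := imgJ (enum {: 'I_l.+1 * 'I_(palette l).+1}).
  apply: (@img_sub (Order.compl (diag completion o0 o1))).
    move=> a /= nd; have [//|[c ec]] := diag_or_edge a.
    by apply: JP ec; rewrite mem_enum.
  by rewrite (hom_compl h_hom) (hom_diag h_hom).
by exists c, s.
Qed.

Lemma joined_level x i : exists y, joined (eq^~ (level_label i)) x y.
Proof.
have : img (cyl o1 (edge o0 o1 (eq^~ (level_label i)))) (fun=> x).
  by rewrite cyl_edge_level (hom_top h_hom).
rewrite (hom_cyl h_hom) => -[t et eqt]; exists (t o1), t; split=> //.
by rewrite -eqt.
Qed.

(** A fixed point [x] has a neighbour at every level, and these neighbours differ because edges of
    different levels are disjoint. *)
Lemma base_infinite : exists y : nat -> U, injective y.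
Proof.
have [x] : exists x : U, True.
  apply: contrapT => no; apply: h_nontrivial; apply/seteqP; split=> // s _.
    by case: no; exists (s o0).
  by case: no; exists (s o0).
move=> _; have /choice[y yP] := joined_level x; exists y => i j eq_y.
apply: contrapT => ne_ij.
have [s [s0 s1 es]] := yP i.
have es' : img (edge o0 o1 (eq^~ (level_label j))) s.
  by apply: joinedP; rewrite s0 s1 eq_y.
have disj : edge o0 o1 (eq^~ (level_label i)) `&` edge o0 o1 (eq^~ (level_label j)) = set0.
  apply/seteqP; split=> // a [ei ej]; have [t at_] := mem_atomE a.
  by have [_] := edgeP ej at_; have [_ ->] := edgeP ei at_ => -[].
suff : img set0 s by rewrite img0.
by rewrite -disj imgI.
Qed.

Lemma representation_trivial : False.
Proof.
have [y y_inj] := base_infinite.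
have /choice[col colP] : forall q : nat * nat, exists c,
    q.1 != q.2 -> joined (hue_class c) (y q.1) (y q.2).
  move=> [i j] /=; have [_|ne_ij] := eqVneq i j; first by exists (ord0, ord0).
  have [|c cP] := @joined_total (y i) (y j); last by exists c.
  by move=> /y_inj eq_ij; rewrite eq_ij eqxx in ne_ij.
pose C := ('I_l.+1 * 'I_(palette l).+1)%type.
have [m mP] := ramsey_triangle (fun i j => col (i, j)) #|{: C}|.
have [||||i [j [k [/and3P[ij jk ik] eq_jk eq_ik]]]] := mP (enum {: C}) (iota 0 m).
- by rewrite -cardE.
- by rewrite size_iota.
- exact: iota_uniq.
- by move=> i j _ _ _; rewrite mem_enum.
have jij := colP (i, j) ij; apply: (no_joined_triangle jij).
  by rewrite eq_jk; exact: (colP (j, k) jk).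
by rewrite eq_ik; exact: (colP (i, k) ik).
Qed.

End Representation.

Lemma completion_not_RCA : ~ RCA_plus completion.
Proof.
move=> [I [U [h [h_hom h_inj]]]].
(* Any limit-free tuple will do: its type is an atom, which separates [setT] from [set0]. *)
have [t t_lf _] := limit_free_approx lt_nl 0 (fun=> 0).
pose a : At alg := exist _ (type_set t_lf) (type_set_atom t_lf).
have /(congr1 (fun X : set (At alg) => X a)) /= : setT = set0 :> completion.
  apply: h_inj => i; apply: contrapT; exact: representation_trivial (h_hom i).
by rewrite -falseE => <-.
Qed.

End CompletionNotRepresentable.

Theorem theorem3p15 (n l : nat) (E : fo_expansion n) (hn : 2 < n) (hl : n < l)
    (hvars : forall (o : op_sym E) (x : nat), x \in fo_vars (op_def o) -> x < l)
    (hadd : completely_additive (@RCA_plus n E)) :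
  ~ atom_canonical (@RCA_plus n E).
Proof.
move=> /(_ _ (definable_alg_RCA hl hvars) (definable_atomic hl)).
exact: completion_not_RCA.
Qed.
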